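(* For any symmetric probability measure $\mu$ on $\mathbb{R}$, $$\Gamma(\mu|\mathrm{b})\le\Gamma^*(\mu|\mathrm{b})\qquad\text{and}\qquad\Psi(\mu|\mathrm{b})\le\Psi^*(\mu|\mathrm{b}).$$
   Context: $\mathrm{b}=\frac12\delta_{-1}+\frac12\delta_{1}$ is the Rademacher distribution. For a symmetric probability measure $\mu$ on $\mathbb{R}$: $\Gamma(\mu|\mathrm{b})=\frac12\int x^2\,d\mu(x)-\int\log|x|\,d\mu(x)-\frac12\in[0,+\infty]$, understood as the integral $\int\left(\frac12x^2-\log|x|-\frac12\right)d\mu(x)$ of a nonnegative function; $\Psi(\mu|\mathrm{b})=\iint\frac{\log x^2-\log y^2}{x^2-y^2}\,d\mu(x)\,d\mu(y)+\int x^2\,d\mu(x)-2\in[0,+\infty]$, where the integrand of the double integral is understood with its continuous extension on the diagonal $x^2=y^2$ (value $1/x^2$, and $+\infty$ if $x=0$ or $y=0$); $\Gamma^*(\mu|\mathrm{b})=\frac12\int x^2\,d\mu(x)+\frac12\log\int\frac1{x^2}\,d\mu(x)-\frac12$; $\Psi^*(\mu|\mathrm{b})=\int\frac1{x^2}\,d\mu(x)+\int x^2\,d\mu(x)-2$. Conventions: $1/0=+\infty$, $\log(+\infty)=+\infty$; the value $+\infty$ is allowed. *)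

(* Defs.v *)
From HB Require Import structures.
From mathcomp Require Import all_boot all_order all_algebra.
From mathcomp Require Import all_classical all_reals all_analysis.

Set Implicit Arguments.
Unset Strict Implicit.
Unset Printing Implicit Defensive.
Import Order.TTheory GRing.Theory Num.Theory.
Import numFieldNormedType.Exports.

Local Open Scope classical_set_scope.
Local Open Scope ring_scope.
Local Open Scope ereal_scope.

Definition symmetric_prob (R : realType)
    (mu : probability (measurableTypeR R) R) : Prop :=
  forall A : set (measurableTypeR R), measurable A ->
    mu [set x : R | A (- x)%R] = mu A.

(* [lne 0 = -oo], so the integrand is +oo at x = 0. It is nonnegative, hence
   the integral is always meaningful in [0, +oo], even when the integral of
   x^2 is infinite or that of log |x| is undefined. *)
Definition Gamma_b (R : realType)
    (mu : probability (measurableTypeR R) R) : \bar R :=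
  \int[mu]_x ((2^-1 * x ^+ 2)%:E - lne `|x|%:E - (2^-1)%:E).

(* The logarithmic difference quotient (log x^2 - log y^2) / (x^2 - y^2),
   extended by continuity to the diagonal x^2 = y^2 and to the axes. *)
Definition log_quotient (R : realType) (x y : R) : \bar R :=
  if ((x == 0) || (y == 0))%R then +oo
  else if (x ^+ 2 == y ^+ 2)%R then ((x ^+ 2)^-1)%:E
  else ((ln (x ^+ 2) - ln (y ^+ 2)) / (x ^+ 2 - y ^+ 2))%:E.

Definition Psi_b (R : realType)
    (mu : probability (measurableTypeR R) R) : \bar R :=
  \int[mu \x mu]_z log_quotient z.1 z.2
  + \int[mu]_x (x ^+ 2)%:E - 2%:E.

(* Below, [((x ^+ 2)%:E)^-1] is the inverse in \bar R, where 0^-1 = +oo. The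
   integral of 1/x^2 is positive, so its [lne] is never -oo. *)
Definition Gammastar_b (R : realType)
    (mu : probability (measurableTypeR R) R) : \bar R :=
  (2^-1)%:E * \int[mu]_x (x ^+ 2)%:E
  + (2^-1)%:E * lne (\int[mu]_x ((x ^+ 2)%:E)^-1) - (2^-1)%:E.

Definition Psistar_b (R : realType)
    (mu : probability (measurableTypeR R) R) : \bar R :=
  \int[mu]_x ((x ^+ 2)%:E)^-1 + \int[mu]_x (x ^+ 2)%:E - 2%:E.

(* Main.v *)
(* Both inequalities are integrated pointwise bounds. For [Gamma], concavity of
   the logarithm gives Jensen's inequality
     int log (1 / x^2) <= log (int 1 / x^2);
   for [Psi], the logarithmic mean of [a = x^2] and [b = y^2] is at least their
   harmonic mean, i.e. (log a - log b) / (a - b) <= (1/a + 1/b) / 2. *)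

Require Import Defs.
From mathcomp Require Import all_boot all_order all_algebra.
From mathcomp Require Import all_classical all_reals all_analysis.
From mathcomp Require Import ring lra.

Set Implicit Arguments.
Unset Strict Implicit.
Unset Printing Implicit Defensive.
Import Order.TTheory GRing.Theory Num.Theory.
Import numFieldNormedType.Exports measurable_realfun.

Local Open Scope ring_scope.
Local Open Scope ereal_scope.

(** * Scalar inequalities for the logarithm *)

Lemma ln_le_subr1 (R : realType) (t : R) : (0 < t -> ln t <= t - 1)%R.
Proof.
by move=> t0; rewrite -[X in ln X](subrKC 1%R) le_ln1Dx// ltrBrDr addNr.
Qed.

(** The gap between the two sides vanishes at 1 and is nondecreasing, since its derivative is half
    of the square of [1 - t^-1]. *)
Lemma ln_le_half_subV (R : realType) (t : R) :
  (1 <= t -> ln t <= (t - t^-1) / 2)%R.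
Proof.
move=> t1.
pose f (u : R) : R := ((u - u^-1) / 2 - ln u)%R.
have df (u : R) : (0 < u)%R -> is_derive u 1%R f ((1 - u^-1) ^+ 2 / 2)%R.
  move=> u0; have un0 : u != 0%R by rewrite gt_eqF.
  have dinv : is_derive u 1%R (fun v : R => v^-1)%R (- (u ^- 2) *: 1)%R.
    by apply: is_deriveV.
  have dln := is_derive1_ln u0.
  rewrite /f; apply: is_derive_eq.
  rewrite -exprVn /GRing.scale/=.
  by field.
suff : (f 1 <= f t)%R by rewrite /f invr1 subrr mul0r ln1 subr0 subr_ge0.
apply: (@ger0_derive1_ndecry _ f 1%R) => //.
- move=> u; rewrite in_itv/= andbT => u1.
  by have [] := df u (lt_trans ltr01 u1).
- move=> u; rewrite in_itv/= andbT => u1; rewrite derive1E.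
  have [_ ->] := df u (lt_trans ltr01 u1).
  by rewrite divr_ge0// sqr_ge0.
- apply: derivable_within_continuous => u; rewrite in_itv/= andbT => u1.
  by have [] := df u (lt_le_trans ltr01 u1).
Qed.

Lemma ln_quotient_ge0 (R : realType) (a b : R) : (0 < a -> 0 < b ->
  0 <= (ln a - ln b) / (a - b))%R.
Proof.
wlog ba : a b / (b <= a)%R.
  move=> H a0 b0; case: (leP b a) => [|/ltW] ab; first exact: H.
  by rewrite -(opprB b) -(opprB (ln b)) invrN mulrNN H.
by move=> a0 b0; rewrite divr_ge0 ?subr_ge0// ler_ln.
Qed.

(** By symmetry take [b < a]. Multiplying by [a - b] turns the right side into
    [(a / b - b / a) / 2], so the claim becomes [ln_le_half_subV] at [t = a / b]. *)
Lemma ln_quotient_le (R : realType) (a b : R) : (0 < a -> 0 < b -> a != b ->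
  (ln a - ln b) / (a - b) <= 2^-1 * a^-1 + 2^-1 * b^-1)%R.
Proof.
wlog ba : a b / (b <= a)%R.
  move=> H a0 b0 ab; case: (leP b a) => [|/ltW] ab'; first exact: H.
  by rewrite -(opprB b) -(opprB (ln b)) invrN mulrNN [leRHS]addrC H// eq_sym.
move=> a0 b0 ab; have {}ba : (b < a)%R by rewrite lt_neqAle eq_sym ab.
rewrite -ln_div ?posrE// ler_pdivrMr ?subr_gt0//.
apply: le_trans (ln_le_half_subV _) _.
  by rewrite ler_pdivlMr// mul1r ltW.
rewrite le_eqVlt; apply/orP; left; apply/eqP.
by field; rewrite !gt_eqF.
Qed.

Section bounds.
Variables (R : realType) (mu : probability (measurableTypeR R) R).
Implicit Types x y : R.

Let V := \int[mu]_x ((x ^+ 2)%:E)^-1.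
Let M := \int[mu]_x (x ^+ 2)%:E.

(** * Pointwise bounds on the logarithmic quotient *)

Lemma inve_sqr_ge0 x : 0 <= ((x ^+ 2)%:E)^-1.
Proof. by rewrite inve_ge0 lee_fin sqr_ge0. Qed.

Lemma log_quotient_ge0 x y : 0 <= log_quotient x y.
Proof.
rewrite /log_quotient; case: ifPn => // /norP[x0 y0].
case: ifPn => _; first by rewrite lee_fin invr_ge0 sqr_ge0.
by rewrite lee_fin ln_quotient_ge0// exprn_even_gt0.
Qed.

(** On the axes the right side is [+oo]; where [x ^+ 2 = y ^+ 2] both sides agree; elsewhere this is
    the scalar bound at the two squares. *)
Lemma log_quotient_le x y : log_quotient x y <=
  (2^-1)%:E * ((x ^+ 2)%:E)^-1 + (2^-1)%:E * ((y ^+ 2)%:E)^-1.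
Proof.
have h0 (z : R) : 0 <= (2^-1)%:E * ((z ^+ 2)%:E)^-1.
  by rewrite mule_ge0 ?inve_sqr_ge0 // lee_fin.
rewrite /log_quotient; case: ifPn => [/orP[] /eqP ->|/norP[x0 y0]].
- rewrite expr0n/= inve0 gt0_muley ?lte_fin// addye//.
  by rewrite gt_eqF// (lt_le_trans _ (h0 _)).
- rewrite expr0n/= inve0 gt0_muley ?lte_fin// addey//.
  by rewrite gt_eqF// (lt_le_trans _ (h0 _)).
rewrite !inver !expf_eq0/= (negbTE x0) (negbTE y0) -!EFinM -EFinD.
case: ifPn => [/eqP <-|xy]; first by rewrite lee_fin; lra.
by rewrite lee_fin ln_quotient_le// exprn_even_gt0.
Qed.

(** * Measurability of the integrands *)

Lemma measurable_invr : measurable_fun [set: R] (@GRing.inv R).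
Proof.
(* Inversion is discontinuous only at 0. That point is split off, with the default value [0^-1 = 0];
   on its open complement continuity suffices. *)
rewrite (_ : @GRing.inv R = fun x => if x == 0%R then 0%R else x^-1%R); last first.
  by apply/funext => x; case: eqP => [->|//]; rewrite invr0.
apply: measurable_fun_if => //; first exact: measurable_fun_eqr.
have pre0 : ((fun x => x == 0%R) @^-1` [set false] = ~` [set 0%R : R])%classic.
  by apply/seteqP; split => x /= /eqP; rewrite ?eqbF_neg// => /negbTE.
rewrite setTI pre0; apply: open_continuous_measurable_fun.
  apply: closed_openC; apply: accessible_closed_set1.
  by apply: hausdorff_accessible; exact: norm_hausdorff.
by move=> x /set_mem /= /eqP; exact: inv_continuous.
Qed.

Lemma measurable_sqr : measurable_fun [set: R] (fun x => x ^+ 2)%R.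
Proof. exact: measurable_funX. Qed.

Lemma measurable_inve_sqr :
  measurable_fun [set: measurableTypeR R] (fun x : R => ((x ^+ 2)%:E)^-1).
Proof.
under eq_fun do rewrite inver.
apply: measurable_fun_ifT => //.
  by apply: measurable_fun_eqr => //; exact: measurable_sqr.
apply/measurable_EFinP; apply: measurableT_comp measurable_invr _.
exact: measurable_sqr.
Qed.

Lemma measurable_log_quotient :
  measurable_fun [set: measurableTypeR R * measurableTypeR R]
    (fun z => log_quotient z.1 z.2).
Proof.
have m1 : measurable_fun [set: measurableTypeR R * measurableTypeR R]
    (fun z => z.1 ^+ 2 : R)%R.
  by apply: measurable_funX; exact: measurable_fst.
have m2 : measurable_fun [set: measurableTypeR R * measurableTypeR R]
    (fun z => z.2 ^+ 2 : R)%R.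
  by apply: measurable_funX; exact: measurable_snd.
rewrite /log_quotient; apply: measurable_fun_ifT => //.
  by apply: measurable_or; apply: measurable_fun_eqr.
apply: measurable_fun_ifT; first exact: measurable_fun_eqr.
  by apply/measurable_EFinP; apply: measurableT_comp measurable_invr _.
apply/measurable_EFinP; apply: measurable_funM.
  by apply: measurable_funB; apply: measurableT_comp => //; exact: measurable_ln.
by apply: measurableT_comp measurable_invr _; exact: measurable_funB.
Qed.

(** * Integration over the product measure and the inequality for Psi *)

Lemma integral_cst_prob (k : \bar R) : \int[mu]_x k = k.
Proof.
rewrite (integral_cst mu measurableT) -[RHS]mule1; congr (_ * _).
exact: probability_setT.
Qed.

(** By Tonelli each summand gives half of the single integral, the other variable contributing total
    mass 1. *)
Lemma integral_prod_half_add (f : R -> \bar R) :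
  measurable_fun [set: measurableTypeR R] f -> (forall x, 0 <= f x) ->
  \int[mu \x mu]_z ((2^-1)%:E * f z.1 + (2^-1)%:E * f z.2) = \int[mu]_x f x.
Proof.
move=> mf f0; have hf0 x : 0 <= (2^-1)%:E * f x by rewrite mule_ge0 ?lee_fin.
have mhf : measurable_fun [set: measurableTypeR R] (fun x => (2^-1)%:E * f x).
  exact: measurable_funeM.
have m1 : measurable_fun [set: measurableTypeR R * measurableTypeR R]
    (fun z => (2^-1)%:E * f z.1).
  by apply: (measurableT_comp mhf); exact: measurable_fst.
have m2 : measurable_fun [set: measurableTypeR R * measurableTypeR R]
    (fun z => (2^-1)%:E * f z.2).
  by apply: (measurableT_comp mhf); exact: measurable_snd.
rewrite ge0_integralD// fubini_tonelli1// fubini_tonelli2//.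
rewrite /fubini_F /fubini_G/=.
under eq_integral do rewrite integral_cst_prob.
rewrite ge0_integralZl_EFin// -ge0_muleDl ?lee_fin//.
by rewrite -EFinD (_ : 2^-1 + 2^-1 = 1)%R ?mul1e//; lra.
Qed.

Lemma Psi_b_le : Psi_b mu <= Psistar_b mu.
Proof.
rewrite /Psi_b /Psistar_b leeD2r// leeD2r//.
(* The single integral of [1 / x^2] is lifted to the product space, where the integrands compare
   pointwise. *)
rewrite -(integral_prod_half_add measurable_inve_sqr inve_sqr_ge0).
apply: ge0_le_integral => //.
- by move=> z _; exact: log_quotient_ge0.
- exact: measurable_log_quotient.
- apply: emeasurable_funD; apply: measurable_funeM.
    by apply: (measurableT_comp measurable_inve_sqr); exact: measurable_fst.
  by apply: (measurableT_comp measurable_inve_sqr); exact: measurable_snd.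
- by move=> z _; exact: log_quotient_le.
Qed.

(** * The inequality for Gamma *)

Lemma integral_inve_sqr_gt0 : 0 < V.
Proof.
rewrite lt_neqAle integral_ge0 ?andbT; last by move=> x _; exact: inve_sqr_ge0.
apply/eqP => V0.
have : \int[mu]_x `|((x ^+ 2)%:E)^-1| = 0.
  rewrite [RHS]V0; apply: eq_integral => x _.
  by rewrite gee0_abs// inve_sqr_ge0.
(* A zero integral makes [1 / x^2] vanish almost everywhere. It vanishes nowhere, so the null set
   [N] is the whole line, which has mass 1. *)
move/(ae_eq_integral_abs _ _ measurable_inve_sqr) => /(_ measurableT) [N [mN N0 sN]].
have NT : N = setT.
  by apply/seteqP; split=> // x _; apply: sN => /= /(_ I) /eqP; rewrite inve_eq0.
have : mu N = 1 by rewrite NT; exact: probability_setT.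
by rewrite N0 => /eqP; rewrite eq_sym onee_eq0.
Qed.

Lemma lne_normr x : x != 0%R -> lne `|x|%:E = (2^-1 * ln (x ^+ 2))%:E.
Proof.
move=> x0; rewrite lne_EFin ?normr_gt0// -[(x ^+ 2)%R]real_normK ?num_real//.
by rewrite lnXn ?normr_gt0//; congr EFin; lra.
Qed.

Lemma measurable_Gamma_integrand : measurable_fun [set: measurableTypeR R]
  (fun x : R => (2^-1 * x ^+ 2)%:E - lne `|x|%:E - (2^-1)%:E).
Proof.
rewrite (_ : (fun x : R => _) = fun x : R => if x == 0%R then +oo
    else (2^-1 * x ^+ 2 - 2^-1 * ln (x ^+ 2) - 2^-1)%:E); last first.
  apply/funext => x; case: eqVneq => [->|x0]; first by rewrite normr0 /= lexx.
  by rewrite lne_normr.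
have m2 := measurable_sqr.
apply: measurable_fun_ifT => //; first exact: measurable_fun_eqr.
apply/measurable_EFinP; apply: measurable_funB => //; apply: measurable_funB.
  exact: measurable_funM.
by apply: measurable_funM => //; apply: measurableT_comp m2; exact: measurable_ln.
Qed.

(** Off 0 this is half of [ln t <= t - 1] at [t = x ^+ 2]. It allows integrals to be compared
    without knowing that [log |x|] is integrable. *)
Lemma Gamma_integrand_ge0 x :
  0 <= (2^-1 * x ^+ 2)%:E - lne `|x|%:E - (2^-1)%:E.
Proof.
have [->|x0] := eqVneq x 0%R; first by rewrite normr0 /= lexx leey.
rewrite lne_normr// -!EFinB lee_fin.
have x20 : (0 < x ^+ 2)%R by rewrite exprn_even_gt0.
by have := ln_le_subr1 x20; lra.
Qed.

(* Tangent-line bound for the logarithm at [c], to be used with [c] the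
   integral of [1 / x^2]. *)
Lemma Gamma_integrand_le (c : R) x : (0 < c)%R ->
  (2^-1 * x ^+ 2)%:E - lne `|x|%:E - (2^-1)%:E <=
  (2^-1)%:E * (x ^+ 2)%:E + ((2^-1 * c^-1)%:E * ((x ^+ 2)%:E)^-1
    + (2^-1 * ln c - 1)%:E).
Proof.
move=> c0; have [->|x0] := eqVneq x 0%R.
  rewrite expr0n/= inve0 gt0_muley ?lte_fin ?mulr_gt0 ?invr_gt0//.
  by rewrite mule0 add0e addye// leey.
have x20 : (0 < x ^+ 2)%R by rewrite exprn_even_gt0.
rewrite lne_normr// inver gt_eqF// -!EFinM -!EFinD lee_fin.
(* This [t] is [1 / x^2] divided by [c]: the tangent at [c] is the tangent at 1 after rescaling. *)
have t0 : (0 < c^-1 * (x ^+ 2)^-1)%R by rewrite mulr_gt0 ?invr_gt0.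
have := ln_le_subr1 t0.
rewrite lnM ?posrE ?invr_gt0// !lnV ?posrE//; lra.
Qed.

Lemma Gamma_b_le : Gamma_b mu <= Gammastar_b mu.
Proof.
have M0 : 0 <= M by apply: integral_ge0 => x _; rewrite lee_fin sqr_ge0.
have V0 := integral_inve_sqr_gt0.
rewrite /Gammastar_b -/M -/V.
(* If [V] or [M] is infinite, the right side is [+oo]; only finite values [c] and [m] remain. *)
case EV : V V0 => [c| |//] V0; last first.
  rewrite /= gt0_muley ?lte_fin// addey ?leey//.
  by rewrite gt_eqF// (lt_le_trans _ (mule_ge0 _ M0))// lee_fin.
rewrite lte_fin in V0.
case EM : M M0 => [m| |//] M0; last first.
  by rewrite lne_EFin// gt0_muley ?lte_fin// leey.
have iM : mu.-integrable setT (fun x => (x ^+ 2)%:E).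
  apply/integrableP; split; first by apply/measurable_EFinP; exact: measurable_sqr.
  under eq_integral do rewrite gee0_abs ?lee_fin ?sqr_ge0//.
  by rewrite -/M EM ltry.
have iV : mu.-integrable setT (fun x => ((x ^+ 2)%:E)^-1).
  apply/integrableP; split; first exact: measurable_inve_sqr.
  under eq_integral do rewrite gee0_abs ?inve_sqr_ge0//.
  by rewrite -/V EV ltry.
have iC (k : R) : mu.-integrable setT (fun=> k%:E).
  by apply: finite_measure_integrable_cst.
(* The tangent is taken at [c = V], the mean of [1 / x^2], as in the proof of Jensen's
   inequality. *)
pose h x := (2^-1)%:E * (x ^+ 2)%:E + ((2^-1 * c^-1)%:E * ((x ^+ 2)%:E)^-1
    + (2^-1 * ln c - 1)%:E).
have ih : mu.-integrable setT h.
  apply: integrableD => //; first exact: integrableZl.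
  by apply: integrableD => //; exact: integrableZl.
apply: (@le_trans _ _ (\int[mu]_x h x)).
  apply: ge0_le_integral => //.
  - by move=> x _; exact: Gamma_integrand_ge0.
  - exact: measurable_Gamma_integrand.
  - exact: measurable_int ih.
  - by move=> x _; exact: Gamma_integrand_le.
rewrite /h integralD//; first last.
- by apply: integrableD => //; exact: integrableZl.
- exact: integrableZl.
rewrite integralD//; last exact: integrableZl.
rewrite !integralZl// integral_cst_prob -/M -/V EM EV.
(* With [c^-1 * c = 1] the linear term contributes [1/2], which turns the constant [-1] of [h] into
   [-1/2]. *)
rewrite lne_EFin// -!EFinM -!EFinD lee_fin -mulrA mulVf ?gt_eqF//; lra.
Qed.

End bounds.

Theorem proposition2p13 (R : realType)
    (mu : probability (measurableTypeR R) R) (mu_sym : symmetric_prob mu) :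
  Gamma_b mu <= Gammastar_b mu /\ Psi_b mu <= Psistar_b mu.
Proof. by split; [exact: Gamma_b_le|exact: Psi_b_le]. Qed.
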